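(* Let $\varepsilon\in\{1,-1\}$ and $n\ge2$. Then $$\sum_{\sigma\in\mathcal D^\Delta_n}\varepsilon^{\ell_B(\sigma)}q^{\mathrm{fmaj}(\sigma)}=[2]_q[4]_q\cdots[2n-2]_q\sum_{k=0}^{n-2}\frac{(-1)^kq^{k^2+k+1}[n-k-1]_q}{[2]_q[4]_q\cdots[2k]_q}\,\varepsilon^{n-k}\left(\frac{1-q}{1-\varepsilon q}\right)^{\lceil (n-k)/2\rceil}.$$
   Context: $B_n$ is the set of words $\sigma=\sigma_1\cdots\sigma_n$ with $\sigma_i\in\{\pm1,\dots,\pm n\}$ and $|\sigma_1|\cdots|\sigma_n|$ a permutation of $[n]$; $\Delta_n=\{\sigma\in B_n:\sigma_n>0\}$; $\mathcal D^\Delta_n$ is the set of $\sigma\in\Delta_n$ with $\sigma_i\ne i$ for all $i$. $\mathrm{inv}$ in usual order, $\ell_B(\sigma)=\mathrm{inv}(\sigma)-\sum_{i:\sigma_i<0}\sigma_i$. Order $\prec$: $-1\prec-2\prec\cdots\prec-N\prec1\prec\cdots\prec N$; $\mathrm{maj}_\prec(w)=\sum_{i:w_i\succ w_{i+1}}i$; $\mathrm{neg}(w)$ counts negative letters; $\mathrm{fmaj}(w)=2\mathrm{maj}_\prec(w)+\mathrm{neg}(w)$. $[m]_q=1+q+\dots+q^{m-1}$; empty products equal $1$. *)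

(* Defs.v *)
From HB Require Import structures.
From mathcomp Require Import all_boot all_order all_algebra all_fingroup.
Set Implicit Arguments. Unset Strict Implicit. Unset Printing Implicit Defensive.
Import Order.TTheory GRing.Theory Num.Theory.
Local Open Scope ring_scope.

(* A signed permutation sigma in B_n is encoded by a pair (s, e) with
   s : {perm 'I_n} and e : {ffun 'I_n -> bool}; its word is
   sigma_{i+1} = -(s i + 1) if e i, and (s i + 1) otherwise (0-indexed positions). *)
Definition sword n (s : {perm 'I_n}) (e : {ffun 'I_n -> bool}) (i : 'I_n) : int :=
  if e i then - ((s i).+1 %:Z) else (s i).+1 %:Z.

Definition inDelta n (s : {perm 'I_n}) (e : {ffun 'I_n -> bool}) : bool :=
  [forall i : 'I_n, (val i == n.-1)%N ==> (0 < sword s e i)].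

Definition inDDelta n (s : {perm 'I_n}) (e : {ffun 'I_n -> bool}) : bool :=
  inDelta s e && [forall i : 'I_n, sword s e i != (val i).+1 %:Z].

Definition sinv n (s : {perm 'I_n}) (e : {ffun 'I_n -> bool}) : nat :=
  #|[set p : 'I_n * 'I_n | (p.1 < p.2)%N && (sword s e p.2 < sword s e p.1)]|.

Definition ellB n (s : {perm 'I_n}) (e : {ffun 'I_n -> bool}) : int :=
  (sinv s e)%:Z - \sum_(i : 'I_n | sword s e i < 0) sword s e i.

(* x "succ" y in the order -1 < -2 < ... < -N < 1 < ... < N *)
Definition prec_gt (x y : int) : bool :=
  if x < 0 then (if y < 0 then `|y| < `|x| else false)
  else (if y < 0 then true else y < x).

Definition smaj n (s : {perm 'I_n}) (e : {ffun 'I_n -> bool}) : nat :=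
  \sum_(i : 'I_n | [exists j : 'I_n, (val j == (val i).+1)%N &&
                         prec_gt (sword s e i) (sword s e j)]) (val i).+1.

Definition sneg n (s : {perm 'I_n}) (e : {ffun 'I_n -> bool}) : nat :=
  #|[set i : 'I_n | sword s e i < 0]|.

Definition fmaj n (s : {perm 'I_n}) (e : {ffun 'I_n -> bool}) : nat :=
  (2 * smaj s e + sneg s e)%N.

Definition qint (R : nzRingType) (m : nat) (q : R) : R := \sum_(i < m) q ^+ i.

(* Main.v *)
Require Import Defs.
From HB Require Import structures.
From mathcomp Require Import all_boot all_order all_algebra all_fingroup.
From mathcomp Require Import zify ring.
Set Implicit Arguments. Unset Strict Implicit. Unset Printing Implicit Defensive.
Import Order.TTheory GRing.Theory Num.Theory.
Local Open Scope ring_scope.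

(* Write a_n for the left-hand side, Q = q^2, and let (n choose k)_Q be the
   Q-binomial.  The map sigma |-> eps^(ell_B sigma) is a character of B_n: for
   eps = -1 it is the sign of |sigma| times (-1)^(neg sigma).  Hence deleting
   the fixed points of sigma preserves eps^ell_B and neg, and it changes the
   descents in a controlled way: call a letter subexcedant (S) if it is negative
   or smaller than its position, and excedant (E) if it is larger; then the
   descents of sigma are those of a shuffle of the reduced derangement with a
   string of zeros, where every S is below 0 and every E above 0.  As the last
   letter of a derangement is an S, the shuffle theorem for maj gives
     c_n := sum over (0 < sigma_n <> n) of eps^ell_B q^fmaj
          = sum_m Q^(n-m) (n-1 choose m-1)_Q a_m,
   which Q-binomial inversion turns into a formula for a_n.  On the other hand
   c_n is computed by deleting the last letter: with eta_i = eps^i q, the sum over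
   the sigma with last letter x is eta_n^r [2]_{eta_1} ... [2n-2]_{eta_{n-1}},
   where r is the number of letters above x in the order "prec". *)

(** * Words and statistics *)

Notation sperm n := ({perm 'I_n} * {ffun 'I_n -> bool})%type.

Notation gti := (fun x y : int => y < x).

(** Indexing by [nat] lets words of different lengths be compared without casts; the default 0 is
    never a letter. *)
Definition letter n (se : sperm n) (t : nat) : int :=
  if insub t is Some i then sword se.1 se.2 i else 0.

(** The relation is a parameter: [prec_gt] serves the words, [gti] the integer codes that later
    replace them. *)
Definition wmaj (gt : rel int) (w : nat -> int) (n : nat) : nat :=
  \sum_(0 <= t < n.-1 | gt (w t) (w t.+1)) t.+1.

Lemma wmajS gt w n :
  wmaj gt w n.+2 = (wmaj gt w n.+1 + gt (w n) (w n.+1) * n.+1)%N.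
Proof.
rewrite /wmaj /= [LHS]big_mkcond big_nat_recr //= -big_mkcond /=.
by case: (gt _ _); rewrite ?mul1n.
Qed.

Lemma eq_wmaj gt gt' w w' n :
  (forall t, (t.+1 < n)%N -> gt (w t) (w t.+1) = gt' (w' t) (w' t.+1)) ->
  wmaj gt w n = wmaj gt' w' n.
Proof.
move=> eqw; rewrite /wmaj [LHS]big_mkcond [RHS]big_mkcond; apply: eq_big_nat.
by move=> t /andP[_ lt_t]; rewrite eqw //; case: n lt_t {eqw}.
Qed.

Lemma letterE n (se : sperm n) (i : 'I_n) : letter se i = sword se.1 se.2 i.
Proof. by rewrite /letter valK. Qed.

Lemma smajE n (se : sperm n) : smaj se.1 se.2 = wmaj prec_gt (letter se) n.
Proof.
case: n se => [|n] se; first by rewrite /smaj /wmaj big_ord0 big_nil.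
rewrite /smaj /wmaj big_mkcond big_ord_recr /= [RHS]big_mkcond big_mkord.
rewrite [X in (_ + X)%N]ifF ?addn0; last first.
  apply/existsP => -[j /andP[/eqP /= ej _]].
  by have := ltn_ord j; rewrite ej ltnn.
apply: eq_bigr => i _; congr (if _ then _ else _).
pose j := lift ord0 i; pose i' := widen_ord (leqnSn n) i.
have ->: (val i).+1 = val j by [].
rewrite letterE -/i'; have -> : val i = val i' by []; rewrite letterE.
apply/existsP/idP => [[k /andP[/eqP ek]]|gtij]; last by exists j; rewrite eqxx.
by congr prec_gt; congr sword; apply: val_inj.
Qed.

Lemma sword_lt0 n s (e : {ffun 'I_n -> bool}) i : (sword s e i < 0) = e i.
Proof. by rewrite /sword; case: (e i); lia. Qed.

Lemma prec_gtE n (se : sperm n) (i j : 'I_n) :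
  prec_gt (sword se.1 se.2 i) (sword se.1 se.2 j) =
  if se.2 i then se.2 j && (se.1 j < se.1 i)%N
  else se.2 j || (se.1 j < se.1 i)%N.
Proof.
rewrite /prec_gt !sword_lt0 /sword.
by case: (se.2 i); case: (se.2 j) => //=; lia.
Qed.

Lemma snegE n s (e : {ffun 'I_n -> bool}) : sneg s e = (\sum_i e i)%N.
Proof.
rewrite /sneg -sum1_card big_mkcond /=; apply: eq_bigr => i _.
by rewrite inE sword_lt0; case: (e i).
Qed.

(** * Appending a last letter *)

Definition ext_ffun n (e : {ffun 'I_n -> bool}) (b : bool) : {ffun 'I_n.+1 -> bool} :=
  [ffun i => if unlift ord_max i is Some j then e j else b].

Lemma ext_ffun_lift n (e : {ffun 'I_n -> bool}) b i :
  ext_ffun e b (lift ord_max i) = e i.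
Proof. by rewrite ffunE liftK. Qed.

Lemma ext_ffun_max n (e : {ffun 'I_n -> bool}) b : ext_ffun e b ord_max = b.
Proof. by rewrite ffunE unlift_none. Qed.

Lemma big_ext_ffun (V : nmodType) n (P : pred {ffun 'I_n.+1 -> bool}) F :
  \sum_(e | P e) F e =
  \sum_(b : bool) \sum_(e : {ffun 'I_n -> bool} | P (ext_ffun e b)) F (ext_ffun e b) :> V.
Proof.
rewrite pair_big_dep /=.
rewrite (reindex (fun be : bool * {ffun 'I_n -> bool} => ext_ffun be.2 be.1)) //=.
exists (fun e => (e ord_max, [ffun i => e (lift ord_max i)])).
  move=> [b e] _ /=; rewrite ext_ffun_max; congr pair.
  by apply/ffunP => i; rewrite ffunE ext_ffun_lift.
move=> e _; apply/ffunP => i; rewrite /= ffunE.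
by case: (unliftP ord_max i) => [j ->|->]; rewrite ?ffunE.
Qed.

Lemma widen_ord_lift n (i : 'I_n) : widen_ord (leqnSn n) i = lift ord_max i.
Proof. by apply: val_inj; rewrite /= /bump leqNgt ltn_ord. Qed.

Lemma sum_ext_ffun n (e : {ffun 'I_n -> bool}) b :
  (\sum_i ext_ffun e b i = \sum_i e i + b)%N.
Proof.
rewrite big_ord_recr /= ext_ffun_max; congr addn; apply: eq_bigr => i _.
by rewrite widen_ord_lift ext_ffun_lift.
Qed.

(** [lift] makes room for the new absolute value j+1 by raising the absolute values from j+1 on, so
    relative order is kept. *)
Definition add_last n (se : sperm n) (j : 'I_n.+1) (b : bool) : sperm n.+1 :=
  (lift_perm ord_max j se.1, ext_ffun se.2 b).


Lemma add_last_inj n j b : injective (fun se : sperm n => add_last se j b).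
Proof.
move=> [s e] [s' e'] eqf; congr pair.
  apply/permP => i; apply: (@lift_inj _ j).
  have /= := congr1 (fun z : sperm n.+1 => z.1 (lift ord_max i)) eqf.
  by rewrite !lift_perm_lift.
apply/ffunP => i; have /= := congr1 (fun z : sperm n.+1 => z.2 (lift ord_max i)) eqf.
by rewrite !ext_ffun_lift.
Qed.

Lemma add_last_bij n :
  bijective (fun x : 'I_n.+1 * bool * sperm n => add_last x.2 x.1.1 x.1.2).
Proof.
apply: inj_card_bij => [[[j b] se] [[j' b'] se'] /= eqf|].
  have [ej eb]: j = j' /\ b = b'.
    split.
      by have:= congr1 (fun z : sperm n.+1 => z.1 ord_max) eqf; rewrite /= !lift_perm_id.
    by have:= congr1 (fun z : sperm n.+1 => z.2 ord_max) eqf; rewrite /= !ext_ffun_max.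
  by move: eqf; rewrite -ej -eb => /add_last_inj ->.
have cardS m : #|{: {perm (ordinal m)}}| = m`!.
  by rewrite -card_Sn; apply: eq_card => s; rewrite !inE.
rewrite !card_prod !cardS !card_ord !card_ffun !card_bool !card_ord factS expnS; lia.
Qed.

Lemma add_lastP n (se : sperm n.+1) : exists j b se', se = @add_last n se' j b.
Proof.
by have [g _ gK] := @add_last_bij n; exists (g se).1.1, (g se).1.2, (g se).2; rewrite gK.
Qed.

Lemma big_add_last (V : nmodType) n (F : sperm n.+1 -> V) :
  \sum_(se : sperm n.+1) F se =
  \sum_(j : 'I_n.+1) \sum_(b : bool) \sum_(se : sperm n) F (add_last se j b).
Proof.
rewrite (reindex _ (onW_bij _ (@add_last_bij n))) /=.
by rewrite pair_big pair_big /=.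
Qed.

Lemma big_add_last_eq (V : nmodType) n (j : 'I_n.+1) b (F : sperm n.+1 -> V) :
  \sum_(se : sperm n.+1 | (se.1 ord_max == j) && (se.2 ord_max == b)) F se =
  \sum_(se : sperm n) F (add_last se j b).
Proof.
rewrite big_mkcond big_add_last (bigD1 j) //= [X in _ + X]big1 ?addr0; last first.
  move=> j' ne_j; rewrite big1 // => b' _; rewrite big1 // => se _.
  by rewrite lift_perm_id (negbTE ne_j).
rewrite (bigD1 b) //= [X in _ + X]big1 ?addr0; last first.
  move=> b' ne_b; rewrite big1 // => se _.
  by rewrite ext_ffun_max (negbTE ne_b) andbF.
by apply: eq_bigr => se _; rewrite lift_perm_id ext_ffun_max !eqxx.
Qed.

Lemma ltn_lift n (j : 'I_n.+1) (x y : 'I_n) : (lift j x < lift j y)%N = (x < y)%N.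
Proof. by rewrite /= !ltnNge leq_bump2. Qed.

Lemma letter_add_last n (se : sperm n) j b (i : 'I_n) :
  letter (add_last se j b) i = sword (add_last se j b).1 (add_last se j b).2 (lift ord_max i).
Proof. by rewrite -letterE lift_max. Qed.

(** Here [i] is the old last value before the shift by [lift j]; it ends up above [j] exactly when
    [j <= i]. *)
Definition descends (i : nat) (a : bool) (j : nat) (b : bool) : bool :=
  if a then b && (j <= i)%N else b || (j <= i)%N.

Lemma smaj_add_last n (se : sperm n.+1) (j : 'I_n.+2) b :
  smaj (add_last se j b).1 (add_last se j b).2 =
  (smaj se.1 se.2 + descends (se.1 ord_max) (se.2 ord_max) j b * n.+1)%N.
Proof.
rewrite !smajE wmajS; congr (_ + _ * _)%N.
  apply: eq_wmaj => t lt_t; pose k := Ordinal lt_t; pose i := Ordinal (ltnW lt_t).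
  have -> : t.+1 = k by []; have -> : t = i by [].
  rewrite !letter_add_last !letterE !prec_gtE /=.
  by rewrite !ext_ffun_lift !lift_perm_lift ltn_lift.
congr (_ _ : nat).
rewrite (letter_add_last se j b ord_max : letter _ n = _).
rewrite (letterE (add_last se j b) ord_max : letter _ n.+1 = _).
rewrite prec_gtE /descends /= !ext_ffun_lift !lift_perm_lift !lift_perm_id !ext_ffun_max.
by rewrite (_ : (j < _)%N = (j <= se.1 ord_max)%N) //= /bump; case: leqP; lia.
Qed.

(** * Inversions and the parity of ell_B *)

Lemma sinvE n (se : sperm n) : sinv se.1 se.2 =
  (\sum_(i < n) \sum_(k < n) ((i < k)%N && (sword se.1 se.2 k < sword se.1 se.2 i)%R))%N.
Proof.
rewrite /sinv -sum1_card pair_big big_mkcond /=.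
by apply: eq_bigr => p _; rewrite inE; case: ifP.
Qed.

Lemma sword_gt_last n (se : sperm n) (j : 'I_n.+1) b (i : 'I_n) :
  let se' := add_last se j b in
  (sword se'.1 se'.2 ord_max < sword se'.1 se'.2 (lift ord_max i)) =
  if b then se.2 i ==> (se.1 i < j)%N else ~~ se.2 i && (j <= se.1 i)%N.
Proof.
rewrite /= /sword ext_ffun_max ext_ffun_lift lift_perm_id lift_perm_lift /= /bump.
by case: b; case: (se.2 i); case: leqP => /=; lia.
Qed.

Lemma sword_lift_lt n (se : sperm n) (j : 'I_n.+1) b (i k : 'I_n) :
  let se' := add_last se j b in
  (sword se'.1 se'.2 (lift ord_max i) < sword se'.1 se'.2 (lift ord_max k)) =
  (sword se.1 se.2 i < sword se.1 se.2 k).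
Proof.
have := ltn_lift j (se.1 i) (se.1 k); have := ltn_lift j (se.1 k) (se.1 i).
rewrite /= /sword !ext_ffun_lift !lift_perm_lift /=.
by case: (se.2 i); case: (se.2 k) => /=; lia.
Qed.

Lemma sinv_add_last n (se : sperm n) (j : 'I_n.+1) b :
  sinv (add_last se j b).1 (add_last se j b).2 =
  (sinv se.1 se.2 + \sum_(i < n)
     (if b then se.2 i ==> (se.1 i < j)%N else ~~ se.2 i && (j <= se.1 i)%N))%N.
Proof.
rewrite !sinvE big_ord_recr /= [X in (_ + X)%N]big1 ?addn0; last first.
  by move=> k _; rewrite ltnNge -ltnS ltn_ord.
rewrite -big_split; apply: eq_bigr => i _.
rewrite big_ord_recr /= widen_ord_lift ltn_ord sword_gt_last; congr addn.
apply: eq_bigr => k _; rewrite widen_ord_lift.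
have -> // : k = lift ord_max k :> nat by rewrite lift_max.
by rewrite sword_lift_lt lift_max.
Qed.

Lemma sum_ord_geq n (j : 'I_n.+1) : (\sum_(i < n) (j <= i) = n - j)%N.
Proof.
rewrite -(big_mkord predT (fun i => (j <= i)%N : nat)).
rewrite (big_cat_nat (n := j)) //=; last by rewrite -ltnS.
rewrite big_nat big1 => [|i /andP[_ lt_ij]]; last by rewrite leqNgt lt_ij.
rewrite add0n -[RHS]muln1 -sum_nat_const_nat big_nat [RHS]big_nat.
by apply: eq_bigr => i /andP[-> _].
Qed.

(* Let x be the last letter.  If x > 0, the other letters larger than x in absolute
   value each contribute once to the left-hand sum, as an inversion with x or by the
   drop of their absolute value when x is deleted; if x < 0, all the other letters
   do, and x itself adds |x|. *)
Lemma odd_ellB n (se : sperm n) :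
  odd (sinv se.1 se.2 + \sum_i se.2 i * (se.1 i).+1) = odd_perm se.1 (+) odd (\sum_i se.2 i).
Proof.
elim: n => [|n IHn] in se *.
  rewrite sinvE !big_ord0; case: se => s e /=.
  by rewrite [s]permS0 odd_perm1.
have [j [b [se' ->]]] : exists j b se', se = @add_last n se' j b.
  exact: add_lastP.
rewrite sinv_add_last.
have -> : (\sum_i (add_last se' j b).2 i * ((add_last se' j b).1 i).+1 =
  \sum_i (se'.2 i * (j <= se'.1 i) + se'.2 i * (se'.1 i).+1) + b * j.+1)%N.
  rewrite big_ord_recr /= ext_ffun_max lift_perm_id; congr addn.
  apply: eq_bigr => i _.
  rewrite widen_ord_lift ext_ffun_lift lift_perm_lift /= /bump -mulnDr; congr muln.
  by rewrite addnS.
rewrite sum_ext_ffun odd_lift_perm big_split /=.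
set S := (\sum_(i < n) _ * _.+1)%N; set T := (\sum_(i < n) _ * (_ <= _))%N.
set U := (\sum_(i < n) (if _ then _ else _))%N.
have eUT : (U + T = if b then n else n - j)%N.
  rewrite /U /T -big_split /=; case: (b).
    rewrite -[RHS]card_ord -sum1_card; apply: eq_bigr => i _.
    by case: (se'.2 i); case: leqP.
  rewrite -sum_ord_geq [RHS](reindex_inj (@perm_inj _ se'.1)); apply: eq_bigr => i _.
  by case: (se'.2 i); case: leqP.
have -> : (sinv se'.1 se'.2 + U + (T + S + b * j.+1) =
  sinv se'.1 se'.2 + S + (U + T + b * j.+1))%N by lia.
rewrite oddD IHn eUT; have := ltn_ord j; rewrite ltnS => le_j.
rewrite !oddD; move: (odd_perm _) (odd (\sum_i _)) => x y.
case: (b); rewrite ?mul1n ?mul0n ?addn0 /= ?oddB //; move: (odd n) (odd j) x y;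
by do 4![case].
Qed.

(** * The sum over signed permutations with given last letter *)

(** When eps^2 = 1 only the parity of ell_B matters; in this form the effect of deleting a letter or
    a fixed point is visible factor by factor. *)
Definition weight (R : fieldType) (eps q : R) n (se : sperm n) : R :=
  eps ^+ odd_perm se.1 * (eps * q) ^+ (\sum_i se.2 i) * (q ^+ 2) ^+ smaj se.1 se.2.

Lemma ellBE n (se : sperm n) :
  ellB se.1 se.2 = (sinv se.1 se.2 + \sum_i se.2 i * (se.1 i).+1)%N.
Proof.
rewrite /ellB PoszD; congr (_ + _); rewrite -sumrN big_mkcond /=.
rewrite (big_morph Posz PoszD (erefl _)); apply: eq_bigr => i _.
by rewrite sword_lt0 /sword; case: (se.2 i); rewrite ?opprK ?mul1n ?mul0n.
Qed.

Lemma expr_odd (R : pzRingType) (x : R) k : x ^+ 2 = 1 -> x ^+ k = x ^+ odd k.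
Proof.
by move=> x2; rewrite -[in LHS](odd_double_half k) exprD -mul2n exprM x2 expr1n mulr1.
Qed.

Lemma weightE (R : fieldType) (eps q : R) n (se : sperm n) : eps ^+ 2 = 1 ->
  eps ^ (ellB se.1 se.2) * q ^+ (fmaj se.1 se.2) = weight eps q se.
Proof.
move=> eps2; rewrite ellBE -exprnP expr_odd // odd_ellB /fmaj snegE /weight.
set m := (\sum_i _)%N.
have -> : eps ^+ (odd_perm se.1 (+) odd m) = eps ^+ odd_perm se.1 * eps ^+ m.
  by rewrite -exprD [RHS]expr_odd // oddD oddb.
rewrite exprMn exprD exprM -!mulrA; congr (_ * (_ * _)); exact: mulrC.
Qed.

Lemma qint_split (R : nzRingType) m k (x : R) : qint (m + k) x = qint m x + x ^+ m * qint k x.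
Proof.
rewrite /qint big_split_ord /= mulr_sumr; congr (_ + _).
by apply: eq_bigr => i _; rewrite exprD.
Qed.

Lemma qintM1 (R : nzRingType) m (x : R) : (1 - x) * qint m x = 1 - x ^+ m.
Proof. by rewrite -opprB mulNr -[in RHS]opprB subrX1. Qed.

Lemma weight_add_last (R : fieldType) (eps q : R) n (se : sperm n.+1) (j : 'I_n.+2) b :
  eps ^+ 2 = 1 ->
  weight eps q (add_last se j b) =
  eps ^+ (n.+1 + j) * (eps * q) ^+ b * weight eps q se *
  (q ^+ 2) ^+ (descends (se.1 ord_max) (se.2 ord_max) j b * n.+1)%N.
Proof.
move=> eps2; rewrite /weight smaj_add_last sum_ext_ffun odd_lift_perm.
rewrite !exprD.
have -> : eps ^+ (odd (ord_max : 'I_n.+2) (+) odd j (+) odd_perm se.1) =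
  eps ^+ (n.+1 + j) * eps ^+ odd_perm se.1.
  by rewrite -exprD [RHS]expr_odd // !oddD oddb.
have mulAC6 (a c d e f g : R) : a * c * (d * e) * (f * g) = a * e * (c * d * f) * g by ring.
rewrite -[eps ^+ n.+1 * _]exprD; exact: mulAC6.
Qed.

Lemma sum_geom_ge (R : nzRingType) (x : R) n j : (j <= n)%N ->
  \sum_(i < n | (j <= i)%N) x ^+ (n - i.+1) = qint (n - j) x.
Proof.
move=> le_jn; rewrite -(big_mkord (fun i => j <= i)%N (fun i => x ^+ (n - i.+1))).
rewrite big_nat_rev /= add0n big_mkcond /= (big_cat_nat (n := n - j)) //=; last by rewrite leq_subr.
rewrite [X in _ + X]big_nat [X in _ + X]big1 ?addr0; last first.
  by move=> i /andP[le_i lt_i]; rewrite ifF //; lia.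
rewrite /qint -(big_mkord predT (fun i => x ^+ i)); apply: eq_big_nat => i /andP[_ lt_i].
by rewrite ifT; [congr (_ ^+ _)|]; lia.
Qed.

Lemma sum_geom_lt (R : nzRingType) (x : R) n j : (j <= n)%N ->
  \sum_(i < n | ~~ (j <= i)%N) x ^+ (n - i.+1) = x ^+ (n - j) * qint j x.
Proof.
move=> le_jn.
have := sum_geom_ge x (leq0n n); rewrite (bigID (fun i : 'I_n => (j <= i)%N)) /= sum_geom_ge // subn0.
have -> : qint n x = qint (n - j) x + x ^+ (n - j) * qint j x by rewrite -qint_split subnK.
by move=> /addrI.
Qed.

(* The parameter eta_i of the header. *)
Definition twist (R : fieldType) (eps q : R) i : R := eps ^+ i * q.

(** The exponent is the number of letters above the last one in the order of [prec_gt]. The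
    induction sums over the letter preceding the last. *)
Lemma sum_weight_last (R : fieldType) (eps q : R) n (j : 'I_n.+1) (b : bool) : eps ^+ 2 = 1 ->
  \sum_(se : sperm n.+1 | (se.1 ord_max == j) && (se.2 ord_max == b)) weight eps q se =
  twist eps q n.+1 ^+ (n - j + b * n.+1) * \prod_(1 <= i < n.+1) qint (2 * i) (twist eps q i).
Proof.
move=> eps2; elim: n => [|n IHn] in j b *.
  rewrite big_add_last_eq big_nil mulr1.
  rewrite (eq_bigl (pred1 (1%g, [ffun=> false]))); last first.
    move=> [s e]; rewrite inE; apply/esym/eqP; congr pair; first exact: permS0.
    by apply/ffunP => -[].
  rewrite big_pred1_eq /weight sum_ext_ffun big_ord0 add0n smajE /wmaj big_nil mulr1.
  rewrite [j]ord1 odd_lift_perm /= odd_perm1 expr0 mul1r muln1 /twist.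
  by case: b; rewrite ?expr0 ?expr1.
rewrite big_add_last_eq.
rewrite (eq_bigr _ (fun se _ => weight_add_last q se j b eps2)).
rewrite (partition_big (fun se : sperm n.+1 => (se.1 ord_max, se.2 ord_max)) predT) //=.
rewrite -(pair_big predT predT (fun i a => \sum_(se : sperm n.+1 |
  (se.1 ord_max, se.2 ord_max) == (i, a))
  (eps ^+ (n.+1 + j) * (eps * q) ^+ b * weight eps q se *
  (q ^+ 2) ^+ (descends (se.1 ord_max) (se.2 ord_max) j b * n.+1)%N))) /=.
set P := \prod_(1 <= i < n.+2) _; set N := n.+1; set eta := twist eps q N.
set P' := \prod_(1 <= i < n.+1) qint (2 * i) (twist eps q i) in IHn.
have eP : P = P' * qint (2 * N) eta by rewrite /P big_nat_recr.
transitivity (eps ^+ (N + j) * (eps * q) ^+ b * P' *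
  \sum_(i < N) \sum_(a : bool) eta ^+ (N - i.+1 + a * N) *
   (q ^+ 2) ^+ (descends i a j b * N)).
  rewrite mulr_sumr; apply: eq_bigr => i _; rewrite mulr_sumr; apply: eq_bigr => a _.
  transitivity (\sum_(se : sperm N | (se.1 ord_max == i) && (se.2 ord_max == a))
    (eps ^+ (n.+1 + j) * (eps * q) ^+ b *
      (q ^+ 2) ^+ (descends i a j b * N)) * weight eps q se).
    apply: eq_big => [se|se /eqP[-> ->]]; first by rewrite xpair_eqE.
    by rewrite mulrAC.
  rewrite -mulr_sumr IHn subSS; ring.
have q2 : q ^+ 2 = eta ^+ 2 by rewrite exprMn exprAC eps2 expr1n mul1r.
have le_j : (j <= N)%N by rewrite -ltnS.
(* Index the 2N possible previous letters by the number r of letters above them. Those above the new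
   letter are the r < r', where r' = N - j + bN; they create a descent, worth eta^(2N). The
   exponents are therefore r', ..., r' + 2N - 1. *)
have key : \sum_(i < N) \sum_(a : bool) eta ^+ (N - i.+1 + a * N) *
   (q ^+ 2) ^+ (descends i a j b * N)
   = eta ^+ (N - j + b * N) * qint (2 * N) eta.
  rewrite exchange_big /= big_bool /= q2 /descends.
  pose A := qint (N - j) eta; pose B := qint j eta.
  pose X := eta ^+ (N - j); pose Y := eta ^+ j; pose G := qint N eta.
  (* [F i h] counts the descent created; it takes the value [d] where [j <= i] and [e] elsewhere. *)
  have split_sum (c d e : nat) (F : 'I_N -> bool -> nat) :
      (forall i : 'I_N, F i (j <= i)%N = if (j <= i)%N then d else e) ->
      \sum_(i < N) eta ^+ (N - i.+1 + c) * (eta ^+ 2) ^+ (F i (j <= i)%N * N) =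
      eta ^+ c * ((eta ^+ (2 * N)) ^+ d * A + (eta ^+ (2 * N)) ^+ e * (X * B)).
    move=> eF; rewrite (bigID (fun i : 'I_N => (j <= i)%N)) /= mulrDr.
    rewrite /A /X /B -(sum_geom_ge eta le_j) -(sum_geom_lt eta le_j) !mulr_sumr.
    have shuffle (k f : nat) : eta ^+ (k + c) * (eta ^+ 2) ^+ (f * N) =
        eta ^+ c * ((eta ^+ (2 * N)) ^+ f * eta ^+ k).
      rewrite -!exprM exprD -mulrA mulrC -mulrA; congr (_ * (_ ^+ _ * _)); lia.
    by congr (_ + _); apply: eq_bigr => i; [move=> h|move=> /negbTE h]; rewrite eF h shuffle.
  have eG : G = A + X * B by rewrite -qint_split subnK.
  have eN : eta ^+ N = X * Y by rewrite -exprD subnK.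
  have e2N : qint (2 * N) eta = B + Y * (G + X * Y * A).
    by rewrite -eN -!qint_split; congr qint; lia.
  rewrite (split_sum _ b 0%N (fun _ h => b && h)) => [|i]; last by case: b; case: leqP.
  rewrite (split_sum _ 1%N b (fun _ h => b || h)) => [|i]; last by case: b; case: leqP.
  have e2N' : eta ^+ (2 * N) = (X * Y) ^+ 2 by rewrite mulnC exprM eN.
  by rewrite e2N e2N' exprD -/X; case: b; rewrite /= ?mul1n ?mul0n eN eG; ring.
have twistS : twist eps q n.+2 = eps * eta by rewrite /twist exprS mulrA.
rewrite key eP twistS -/N.
have epsD k : eps ^+ (N + j + k) = eps ^+ (N - j + k).
  by rewrite expr_odd // [RHS]expr_odd //; congr (eps ^+ nat_of_bool _); rewrite !oddD oddB.
case: b {key}.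
  have -> : (N - j + true * N.+1)%N = (N - j + N).+1 by rewrite mul1n addnS.
  have epsNN : eps ^+ N * eps ^+ N = 1 by rewrite -expr2 exprAC eps2 expr1n.
  rewrite /= mul1n expr1 exprSr [(eps * eta) ^+ _]exprMn -epsD (exprD _ (N + j) N).
  set u := eta ^+ _; set v := qint _ _.
  have -> : eps * eta = eps * (eps ^+ N * q) by [].
  move: u v (eps ^+ (N + j)) (eps ^+ N) epsNN => u v w x xx. ring: xx.
rewrite !mul0n !addn0; have epsD0 := epsD 0%N; rewrite !addn0 in epsD0.
by rewrite [(eps * eta) ^+ _]exprMn epsD0 expr0; ring.
Qed.

(** A positive last letter other than n+1 has between 1 and n letters above it, whence eta
    [n]_eta. *)
Lemma sum_weight_nonmax (R : fieldType) (eps q : R) n : eps ^+ 2 = 1 ->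
  \sum_(se : sperm n.+1 | ~~ se.2 ord_max && (se.1 ord_max != ord_max)) weight eps q se =
  twist eps q n.+1 * qint n (twist eps q n.+1) *
  \prod_(1 <= i < n.+1) qint (2 * i) (twist eps q i).
Proof.
move=> eps2; set eta := twist _ _ _; set P := \prod_(_ <= _ < _) _.
rewrite (partition_big (fun se : sperm n.+1 => se.1 ord_max) (fun j => j != ord_max)) /=;
  last by move=> se /andP[].
transitivity (\sum_(j : 'I_n.+1 | j != ord_max) eta ^+ (n - j) * P).
  apply: eq_bigr => j ne_j; rewrite -[(n - j)%N]addn0 -(sum_weight_last q j false eps2).
  apply: eq_bigl => se; case: (se.1 ord_max =P j) => [->|]; last by rewrite andbF.
  by rewrite ne_j; case: (se.2 ord_max).
rewrite -mulr_suml; congr (_ * _).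
rewrite big_mkcond big_ord_recr /= eqxx addr0 /qint mulr_sumr.
rewrite -(big_mkord predT (fun i => eta * eta ^+ i)) big_nat_rev big_mkord.
apply: eq_bigr => i _; rewrite ifT; last by rewrite -val_eqE /= neq_ltn ltn_ord.
by rewrite -exprS; congr (_ ^+ _); have := ltn_ord i; rewrite /=; lia.
Qed.

(** Since (eps q)^(2m) = q^(2m), replacing q by eps q only changes the denominator of the geometric
    sum. *)
Lemma qint_twist (R : fieldType) (eps q : R) m k : eps ^+ 2 = 1 -> 1 - eps * q != 0 ->
  qint (2 * m) (twist eps q k) = qint (2 * m) q * ((1 - q) / (1 - eps * q)) ^+ odd k.
Proof.
move=> eps2 nz; rewrite /twist expr_odd //; case: (odd k); last by rewrite expr0 mul1r mulr1.
rewrite !expr1; apply: (mulfI nz).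
rewrite qintM1 exprMn exprM eps2 expr1n mul1r -(qintM1 (2 * m) q).
by rewrite mulrCA (mulrC (1 - eps * q)) divfK // mulrC.
Qed.

Lemma prod_twist (R : fieldType) (eps q : R) n : eps ^+ 2 = 1 -> 1 - eps * q != 0 ->
  \prod_(1 <= i < n.+1) qint (2 * i) (twist eps q i) =
  ((1 - q) / (1 - eps * q)) ^+ (n.+1./2) * \prod_(1 <= i < n.+1) qint (2 * i) q.
Proof.
move=> eps2 nz; elim: n => [|n IHn]; first by rewrite !big_nil mulr1.
rewrite !(@big_nat_recr _ _ _ n.+1) //= IHn qint_twist //.
have -> : (n./2.+1 = n.+1./2 + odd n.+1)%N by lia.
rewrite exprD; set P := \prod_(_ <= _ < _) _; set r := _ / _; ring.
Qed.

Lemma sum_weight_nonmaxE (R : fieldType) (eps q : R) n : eps ^+ 2 = 1 -> 1 - eps * q != 0 ->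
  \sum_(se : sperm n.+1 | ~~ se.2 ord_max && (se.1 ord_max != ord_max)) weight eps q se =
  q * qint n q * eps ^+ n.+1 * ((1 - q) / (1 - eps * q)) ^+ uphalf n.+1 *
  \prod_(1 <= i < n.+1) qint (2 * i) q.
Proof.
move=> eps2 nz; rewrite sum_weight_nonmax // prod_twist // uphalf_half exprD.
(* This factor is really twisted only if n+1 is odd; then n is even, so [qint_twist] applies to it
   too. *)
have -> : qint n (twist eps q n.+1) = qint n q * ((1 - q) / (1 - eps * q)) ^+ odd n.+1.
  have [n_even|n_odd] := boolP (odd n.+1); last first.
    by rewrite /twist expr_odd // (negbTE n_odd) expr0 mul1r mulr1.
  have en : (2 * n./2 = n)%N by move: n_even => /=; lia.
  by have := qint_twist (n./2) n.+1 eps2 nz; rewrite en n_even.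
rewrite {1}/twist.
set P := \prod_(_ <= _ < _) _; set r := _ ^+ odd _; set r' := _ ^+ _./2; ring.
Qed.

(** * Shuffling a word with zeros *)

(** Pascal's rule as definition avoids division, so the shuffle count holds in any commutative
    ring. *)
Fixpoint qbin (R : comNzRingType) (Q : R) (n k : nat) : R :=
  match n, k with
  | _, 0 => 1
  | 0, _.+1 => 0
  | n'.+1, k'.+1 => qbin Q n' k' + Q ^+ k * qbin Q n' k
  end.

Lemma qbin0 (R : comNzRingType) (Q : R) n : qbin Q n 0 = 1.
Proof. by case: n. Qed.

Lemma qbinS (R : comNzRingType) (Q : R) n k :
  qbin Q n.+1 k.+1 = qbin Q n k + Q ^+ k.+1 * qbin Q n k.+1.
Proof. by []. Qed.

Lemma qbin_small (R : comNzRingType) (Q : R) n k : (n < k)%N -> qbin Q n k = 0.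
Proof.
elim: n k => [|n IHn] [|k] //= lt_nk.
by rewrite !IHn ?mulr0 ?addr0 // ltnW.
Qed.

(** The symmetric Pascal rule; the induction for shuffles meets both. *)
Lemma qbinSr (R : comNzRingType) (Q : R) n k : (k <= n)%N ->
  qbin Q n.+1 k.+1 = Q ^+ (n - k) * qbin Q n k + qbin Q n k.+1.
Proof.
elim: n k => [|n IHn] [|k] // le_kn; first by rewrite /= mulr0 mulr1.
  rewrite [LHS]qbinS [in LHS](IHn 0) // [in RHS](qbinS Q n 0) !qbin0 !subn0.
  by rewrite (exprS Q n) expr1; ring.
rewrite qbinS; move: le_kn; rewrite ltnS leq_eqVlt => /predU1P[->|lt_kn].
  by rewrite (@qbin_small _ _ n.+1 n.+2) // subnn mulr0 mul1r.
rewrite [in LHS](IHn k) ?(ltnW lt_kn) // [in LHS](IHn k.+1) //.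
rewrite [in RHS](qbinS Q n k) [in RHS](qbinS Q n k.+1) subSS -(subnSK lt_kn) !exprS; ring.
Qed.

Arguments qbin : simpl never.

(** At a position of the mask this is the index in the shuffled word of the letter placed there. *)
Definition rank n (g : {ffun 'I_n -> bool}) (t : nat) : nat := \sum_(i < n | (i < t)%N) g i.

(* The shuffle of u with a string of zeros in which the positions of the letters
   of u form the mask g. *)
Definition merge_word (u : nat -> int) n (g : {ffun 'I_n -> bool}) (t : nat) : int :=
  if insub t is Some i then if g i then u (rank g t) else 0 else 0.

Lemma merge_wordE u n (g : {ffun 'I_n -> bool}) (i : 'I_n) :
  merge_word u g i = if g i then u (rank g i) else 0.
Proof. by rewrite /merge_word valK. Qed.

Lemma rank_ext n (g : {ffun 'I_n -> bool}) b t : (t <= n)%N -> rank (ext_ffun g b) t = rank g t.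
Proof.
move=> le_t; rewrite /rank big_mkcond big_ord_recr /= ltnNge le_t addn0 [RHS]big_mkcond.
by apply: eq_bigr => i _; rewrite widen_ord_lift ext_ffun_lift.
Qed.

Lemma rank_full n (g : {ffun 'I_n -> bool}) : rank g n = (\sum_i g i)%N.
Proof. by apply: eq_bigl => i; rewrite ltn_ord. Qed.

Lemma merge_word_ext u n (g : {ffun 'I_n -> bool}) b t : (t < n)%N ->
  merge_word u (ext_ffun g b) t = merge_word u g t.
Proof.
move=> lt_t; pose i := Ordinal lt_t.
rewrite (merge_wordE u g i : _ t = _) -[t in LHS](lift_max i).
by rewrite merge_wordE ext_ffun_lift rank_ext ?lift_max // ltnW.
Qed.

Lemma merge_word_ext_max u n (g : {ffun 'I_n -> bool}) b :
  merge_word u (ext_ffun g b) n = if b then u (\sum_i g i)%N else 0.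
Proof.
rewrite (merge_wordE u (ext_ffun g b) ord_max : _ n = _).
by rewrite ext_ffun_max /= rank_ext // rank_full.
Qed.

(** Generating function of maj over the shuffles of length n+1 with m letters of [u], ending with a
    letter of [u] if [b] and with a zero otherwise. *)
Definition merge_sum (R : comNzRingType) (Q : R) u n m (b : bool) : R :=
  \sum_(g : {ffun 'I_n -> bool} | (\sum_i g i + b == m)%N)
    Q ^+ wmaj gti (merge_word u (ext_ffun g b)) n.+1.

Lemma merge_sum0 (R : comNzRingType) (Q : R) u m b : merge_sum Q u 0 m b = (m == b)%:R.
Proof.
rewrite /merge_sum (eq_bigl (fun g : {ffun 'I_0 -> bool} => (m == b) && (g == [ffun=> false]))).
  by case: (m == b); rewrite ?big_pred1_eq ?big_pred0_eq //= /wmaj big_nil.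
move=> g; rewrite big_ord0 add0n eq_sym [g == _](_ : _ = true) ?andbT //.
by apply/eqP/ffunP => -[].
Qed.

(** Dropping the last position leaves m letters of [u], the final entry being a zero or the letter
    of index m-1; the prefactors record a descent at position n+1. *)
Lemma merge_sumS (R : comNzRingType) (Q : R) u n (m : nat) (b : bool) :
  merge_sum Q u n.+1 (m + b)%N b =
  Q ^+ ((b && (u m < 0)%R) * n.+1) * merge_sum Q u n m false +
  (if m is m'.+1 then
     Q ^+ ((if b then (u m < u m')%R else (0 < u m')%R) * n.+1) * merge_sum Q u n m true else 0).
Proof.
have step (a : bool) : \sum_(g : {ffun 'I_n -> bool} | (\sum_i ext_ffun g a i + b == m + b)%N)
      Q ^+ wmaj gti (merge_word u (ext_ffun (ext_ffun g a) b)) n.+2 =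
    Q ^+ (((if b then u m else 0) < (if a then u m.-1 else 0))%R * n.+1) * merge_sum Q u n m a.
  rewrite /merge_sum mulr_sumr; apply: eq_big => [g|g /eqP].
    by rewrite sum_ext_ffun eqn_add2r.
  rewrite sum_ext_ffun => /addIn em.
  rewrite wmajS addnC exprD; congr (_ ^+ _ * _ ^+ _).
    rewrite (merge_word_ext _ _ _ (ltnSn n)) !merge_word_ext_max sum_ext_ffun em.
    by case: a em => //; rewrite addn1 => <-.
  apply: eq_wmaj => t lt_t.
  by rewrite (merge_word_ext _ _ _ lt_t) (merge_word_ext _ _ _ (ltnW lt_t)).
rewrite {1}/merge_sum big_ext_ffun big_bool !step [RHS]addrC; congr (_ + _).
  case: m {step} => [|m] /=; last by case: b.
  by rewrite /merge_sum big_pred0 ?mulr0 // => g; rewrite addn1.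
by case: b {step}.
Qed.

(* The empty word behaves like a word ending in a subexcedant. *)
Definition neg_last (u : nat -> int) m := if m is m'.+1 then u m' < 0 else true.

Lemma wmaj_last (w : nat -> int) m : wmaj gti w m.+1 =
  (wmaj gti w m + (if m is m'.+1 then (w m < w m')%R : nat else 0) * m)%N.
Proof. by case: m => [|m]; [rewrite /wmaj !big_nil | rewrite wmajS]. Qed.

(* The refined induction needs the last letter of the shuffle: removing it leaves
   a shuffle of the same kind, and whether it creates a descent is then known. *)
Lemma merge_sumE (R : comNzRingType) (Q : R) u n m : (forall i, (i < m)%N -> u i != 0) ->
  merge_sum Q u n m false =
    Q ^+ wmaj gti u m * (if neg_last u m then 1 else Q ^+ m) * qbin Q n m /\
  (if m is m'.+1 then merge_sum Q u n m true =
    Q ^+ wmaj gti u m * (if neg_last u m then Q ^+ (n - m') else 1) * qbin Q n m' else True).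
Proof.
elim: n m => [|n IHn] m u_neq0.
  rewrite !merge_sum0; case: m {u_neq0} => [|[|m]] /=.
  - by rewrite /wmaj big_nil !mulr1.
  - rewrite /wmaj big_nil mulr0 mul1r; split=> //.
    by case: ifP; rewrite !mulr1.
  - by rewrite !mulr0.
split.
  have [IH0 IH1] := IHn m u_neq0.
  rewrite -[in LHS](addn0 m) (merge_sumS Q u n m false) mul0n mul1r IH0.
  case: m u_neq0 IH0 IH1 => [|m] u_neq0 IH0 IH1; first by rewrite addr0 !qbin0.
  rewrite IH1 /=; have := u_neq0 m (leqnn _).
  have [le_mn|lt_nm] := leqP m n; last by rewrite !qbin_small ?(mulr0, addr0) //; lia.
  have en : n.+1 = (m.+1 + (n - m))%N by rewrite addSn subnKC.
  rewrite qbinSr // en.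
  set W := Q ^+ wmaj _ _ _; set A := Q ^+ m.+1; set E := Q ^+ (n - m).
  by case: (ltgtP (u m) 0) => // _ _;
    rewrite ?mul0n ?mul1n ?expr0 ?exprD -/A -/E; ring.
case: m u_neq0 => // m u_neq0.
have [IH0 IH1] := IHn m (fun i h => u_neq0 i (ltnW h)).
have := merge_sumS Q u n m true; rewrite addn1 => ->; rewrite IH0 wmaj_last.
have := u_neq0 m (leqnn _); case: m u_neq0 IH0 IH1 => [|m] u_neq0 IH0 IH1.
  rewrite !qbin0 addr0 /= subn0 /wmaj big_nil => um0.
  by case: (u 0 < 0); rewrite ?mul1n ?mul0n !mulr1 ?mul1r.
rewrite {}IH1 {IH0} /= => um0; have := u_neq0 m (leqW (leqnn _)) => um'0.
have [le_mn|lt_nm] := leqP m n; last by rewrite !qbin_small ?(mulr0, addr0) //; lia.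
rewrite subSS.
have en : n.+1 = (m.+1 + (n - m))%N by rewrite addSn subnKC.
have qS := qbinS Q n m; have qSr := qbinSr Q le_mn.
rewrite en !mulnDr !exprD in qS qSr *.
set W := Q ^+ wmaj _ _ _; set A := Q ^+ m.+1 in qS qSr *; set E := Q ^+ (n - m) in qS qSr *.
(* Of the eight combinations of signs and comparison, two are contradictory; each other one is an
   instance of one of the two Pascal rules. *)
case: (ltgtP (u m.+1) 0) um0 => // xs _; case: (ltgtP (u m) 0) um'0 => // ys _;
case: (ltP (u m.+1) (u m)) => xy; rewrite ?mul1n ?mul0n ?expr0 ?mul1r ?mulr1 -/A -/E.
all: try lia.
all: first [rewrite qS; ring | rewrite qSr; ring].
Qed.

(** * Deleting fixed points *)

(* An integer letter with the same descents as the word of se: negative letters of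
   se are below the positive subexcedants, which are below the fixed points, which
   are coded by 0, and the excedants are positive. *)
Definition code_ord n (se : sperm n) (i : 'I_n) : int :=
  if se.2 i then (se.1 i)%:Z - (2 * n)%:Z
  else if (se.1 i < i)%N then (se.1 i)%:Z - n%:Z
  else if se.1 i == i then 0 else (se.1 i).+1.

Definition code n (se : sperm n) (t : nat) : int :=
  if insub t is Some i then code_ord se i else 0.

Lemma codeE n (se : sperm n) (i : 'I_n) : code se i = code_ord se i.
Proof. by rewrite /code valK. Qed.

(** Only adjacent positions t, t+1 are compared. Two positive letters of different classes there are
    distinct and separated by these positions, so a subexcedant is below a fixed point and both are
    below an excedant, whichever comes first. *)
Lemma smaj_code n (se : sperm n) : smaj se.1 se.2 = wmaj gti (code se) n.
Proof.
rewrite smajE; apply: eq_wmaj => t lt_t.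
pose j := Ordinal lt_t; pose i := Ordinal (ltnW lt_t).
rewrite (letterE se i : letter se t = _) (letterE se j : letter se t.+1 = _).
rewrite (codeE se i : code se t = _) (codeE se j : code se t.+1 = _) prec_gtE /code_ord.
have: se.1 i != se.1 j :> nat.
  by rewrite val_eqE (inj_eq perm_inj) -val_eqE /= neq_ltn ltnSn.
rewrite -![_ == (_ : 'I_n)]val_eqE /=; have := ltn_ord (se.1 i); have := ltn_ord (se.1 j).
move: (nat_of_ord (se.1 i)) (nat_of_ord (se.1 j)) => x y.
by case: (se.2 i); case: (se.2 j) => /=; case: (ltngtP x t) => ?; case: (ltngtP y t.+1) => ?; lia.
Qed.

Definition nonfix n (se : sperm n) : {ffun 'I_n -> bool} := [ffun i => se.2 i || (se.1 i != i)].

(** * Positions selected by a mask, and transport along them *)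

Lemma rank_leq n (g : {ffun 'I_n -> bool}) t t' : (t <= t')%N -> (rank g t <= rank g t')%N.
Proof.
move=> le_t; rewrite /rank big_mkcond [leqRHS]big_mkcond; apply: leq_sum => i _.
by case: ifP => // lt_i; rewrite (leq_trans lt_i le_t).
Qed.

Lemma rankS n (g : {ffun 'I_n -> bool}) (i : 'I_n) : rank g i.+1 = (rank g i + g i)%N.
Proof.
rewrite /rank (bigD1 i) //= addnC; congr addn; apply: eq_bigl => j.
by rewrite ltnS ltn_neqAle andbC.
Qed.

Lemma rank_ltn n (g : {ffun 'I_n -> bool}) (i j : 'I_n) :
  g i -> (i < j)%N -> (rank g i < rank g j)%N.
Proof. by move=> gi /(rank_leq g); rewrite rankS gi addn1. Qed.

Lemma rank_surj n (g : {ffun 'I_n -> bool}) k : (k < \sum_i g i)%N ->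
  exists i : 'I_n, g i /\ rank g i = k.
Proof.
elim: n => [|n IHn] in g k *; first by rewrite big_ord0.
pose g' : {ffun 'I_n -> bool} := [ffun i => g (lift ord_max i)].
have -> : g = ext_ffun g' (g ord_max).
  apply/ffunP => i; case: (unliftP ord_max i) => [j ->|->].
    by rewrite ext_ffun_lift ffunE.
  by rewrite ext_ffun_max.
rewrite sum_ext_ffun; have [lt_k _|le_k lt_k] := ltnP k (\sum_i g' i).
  have [i [gi ri]] := IHn _ _ lt_k; exists (lift ord_max i).
  by rewrite ext_ffun_lift lift_max rank_ext ?(ltnW (ltn_ord i)).
exists ord_max; rewrite ext_ffun_max rank_ext // rank_full.
by case: (g ord_max) lt_k => lt_k; split=> //; lia.
Qed.

(** The rank condition says that [f] lists positions of the mask in increasing order; it lists all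
    of them when m is the size of the mask. *)
Definition embeds n m (g : {ffun 'I_n -> bool}) (f : 'I_m -> 'I_n) : Prop :=
  forall k, g (f k) /\ rank g (f k) = k.

Lemma embeds_exists n m (g : {ffun 'I_n -> bool}) :
  (\sum_i g i = m)%N -> exists f : 'I_m -> 'I_n, embeds g f.
Proof.
move=> em; have ex_i (k : 'I_m) : exists i, g i /\ rank g i = k.
  by apply: rank_surj; rewrite em.
by have [f fP] := fin_all_exists ex_i; exists f.
Qed.

Lemma embeds_lt n m (g : {ffun 'I_n -> bool}) (f : 'I_m -> 'I_n) k l :
  embeds g f -> (f k < f l)%N = (k < l)%N.
Proof.
move=> fP; have [[gk rk] [gl rl]] := (fP k, fP l).
apply/idP/idP => [/(rank_ltn gk)|]; first by rewrite rk rl.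
by rewrite -{1}rk -{1}rl; apply: contraTT; rewrite -!leqNgt; apply: rank_leq.
Qed.

Lemma embeds_inj n m (g : {ffun 'I_n -> bool}) (f : 'I_m -> 'I_n) : embeds g f -> injective f.
Proof.
by move=> fP k l efkl; apply: val_inj; rewrite /= -(fP k).2 -(fP l).2 efkl.
Qed.

Lemma embeds_surj n m (g : {ffun 'I_n -> bool}) (f : 'I_m -> 'I_n) i : (\sum_i g i = m)%N ->
  embeds g f -> g i -> exists k, i = f k.
Proof.
move=> em fP gi.
have lt_r : (rank g i < m)%N by have := rank_leq g (ltn_ord i); rewrite rankS gi addn1 rank_full em.
exists (Ordinal lt_r); have [gf rf] := fP (Ordinal lt_r).
apply: val_inj; case: (ltngtP i (f (Ordinal lt_r))) => // [/(rank_ltn gi)|/(rank_ltn gf)];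
  by rewrite rf ltnn.
Qed.

Definition extend n m (f : 'I_m -> 'I_n) (T : Type) (d : 'I_n -> T) (h : 'I_m -> T) (i : 'I_n) : T :=
  if [pick k | f k == i] is Some k then h k else d i.

Lemma extend_in n m (f : 'I_m -> 'I_n) T (d : 'I_n -> T) h k : injective f -> extend f d h (f k) = h k.
Proof.
rewrite /extend => f_inj; case: pickP => [l /eqP/f_inj -> //|/(_ k)].
by rewrite eqxx.
Qed.

Lemma extend_out n m (f : 'I_m -> 'I_n) T (d : 'I_n -> T) h i :
  (forall k, f k != i) -> extend f d h i = d i.
Proof. by rewrite /extend => fi; case: pickP => // k; rewrite (negbTE (fi k)). Qed.

Lemma codom_case n m (f : 'I_m -> 'I_n) i : (exists k, i = f k) \/ (forall k, f k != i).
Proof.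
case: (pickP (fun k => f k == i)) => [k /eqP <-|fi]; [by left; exists k|].
by right=> k; rewrite fi.
Qed.

Lemma extend_permK n m (f : 'I_m -> 'I_n) (p : {perm 'I_m}) : injective f ->
  cancel (extend f id (fun k => f (p k))) (extend f id (fun k => f (p^-1%g k))).
Proof.
move=> f_inj i; case: (codom_case f i) => [[k ->]|fi]; last by rewrite !extend_out.
by rewrite !extend_in // permK.
Qed.

Definition extend_perm n m (f : 'I_m -> 'I_n) (f_inj : injective f) (p : {perm 'I_m}) :=
  perm (can_inj (extend_permK p f_inj)).

Lemma extend_perm_in n m (f : 'I_m -> 'I_n) (f_inj : injective f) p k :
  extend_perm f_inj p (f k) = f (p k).
Proof. by rewrite permE extend_in. Qed.

Lemma extend_perm_out n m (f : 'I_m -> 'I_n) (f_inj : injective f) p i :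
  (forall k, f k != i) -> extend_perm f_inj p i = i.
Proof. by move=> fi; rewrite permE extend_out. Qed.

(** An injection carries a product of transpositions to a product of as many transpositions. *)
Lemma odd_extend_perm n m (f : 'I_m -> 'I_n) (f_inj : injective f) p :
  odd_perm (extend_perm f_inj p) = odd_perm p.
Proof.
case: (prod_tpermP p) => ts -> _; elim: ts => [|t ts IHts].
  rewrite big_nil odd_perm1 (_ : extend_perm _ _ = 1%g) ?odd_perm1 //.
  apply/permP => i; rewrite perm1; case: (codom_case f i) => [[k ->]|fi].
    by rewrite extend_perm_in perm1.
  by rewrite extend_perm_out.
rewrite big_cons odd_permM odd_tperm -IHts.
have -> : extend_perm f_inj (tperm t.1 t.2 * \prod_(t0 <- ts) tperm t0.1 t0.2)%g =
    (tperm (f t.1) (f t.2) * extend_perm f_inj (\prod_(t0 <- ts) tperm t0.1 t0.2))%g.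
  apply/permP => i; rewrite permM; case: (codom_case f i) => [[k ->]|fi].
    by rewrite -inj_tperm // !extend_perm_in permM.
  by rewrite tpermD // !extend_perm_out.
by rewrite odd_permM odd_tperm (inj_eq f_inj).
Qed.

Definition extend_sperm n m (f : 'I_m -> 'I_n) (f_inj : injective f) (se : sperm m) : sperm n :=
  (extend_perm f_inj se.1, [ffun i => extend f (fun=> false) se.2 i]).

Lemma extend_sperm_inj n m (f : 'I_m -> 'I_n) (f_inj : injective f) : injective (extend_sperm f_inj).
Proof.
move=> [p e] [p' e'] eqf; congr pair.
  apply/permP => k; have := congr1 (fun z : sperm n => z.1 (f k)) eqf.
  by rewrite /= !extend_perm_in => /f_inj.
apply/ffunP => k; have := congr1 (fun z : sperm n => z.2 (f k)) eqf.
by rewrite /= !ffunE !extend_in.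
Qed.

Lemma sum_extend_sign n m (f : 'I_m -> 'I_n) (f_inj : injective f) (se : sperm m) :
  (\sum_i (extend_sperm f_inj se).2 i = \sum_k se.2 k)%N.
Proof.
pose h i : nat := (extend_sperm f_inj se).2 i.
rewrite -[LHS]/(\sum_i h i)%N (bigID (fun i => i \in f @: setT)) /=.
rewrite [X in (_ + X)%N]big1 ?addn0 => [|i i_out]; last first.
  rewrite /h ffunE extend_out // => k; apply: contraNneq i_out => <-; exact: imset_f.
rewrite big_imset /= => [|k l _ _ /f_inj //].
by apply: eq_big => k; rewrite ?in_setT // => _; rewrite /h ffunE extend_in.
Qed.

(** As [f] is increasing, it preserves the class of each letter and the comparisons inside a
    class. *)
Lemma code_extend_lt n m (g : {ffun 'I_n -> bool}) (f : 'I_m -> 'I_n) (f_inj : injective f)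
    (se : sperm m) k l : embeds g f ->
  (code (extend_sperm f_inj se) (f k) < code (extend_sperm f_inj se) (f l)) = (code se k < code se l).
Proof.
move=> fP; rewrite !codeE /code_ord /= !ffunE !extend_in // !extend_perm_in.
rewrite -![_ == (_ : 'I__)]val_eqE /=.
have := ltn_ord (f (se.1 k)); have := ltn_ord (f (se.1 l)).
have := ltn_ord (se.1 k); have := ltn_ord (se.1 l).
have := embeds_lt (se.1 k) k fP; have := embeds_lt k (se.1 k) fP.
have := embeds_lt (se.1 l) l fP; have := embeds_lt l (se.1 l) fP.
have := embeds_lt (se.1 k) (se.1 l) fP; have := embeds_lt (se.1 l) (se.1 k) fP.
have := embeds_lt k l fP; have := embeds_lt l k fP.
move: (nat_of_ord (f (se.1 k))) (nat_of_ord (f (se.1 l))) (nat_of_ord (f k)) (nat_of_ord (f l))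
  => a b c d.
move: (nat_of_ord (se.1 k)) (nat_of_ord (se.1 l)) (nat_of_ord k) (nat_of_ord l) => a' b' c' d'.
case: (se.2 k); case: (se.2 l) => /=.
- lia.
- case: (ltngtP b d) => ?; case: (ltngtP b' d') => ?; lia.
- case: (ltngtP a c) => ?; case: (ltngtP a' c') => ?; lia.
- case: (ltngtP b d) => ?; case: (ltngtP b' d') => ?;
  case: (ltngtP a c) => ?; case: (ltngtP a' c') => ?; lia.
Qed.

Lemma code_extend_sgn n m (g : {ffun 'I_n -> bool}) (f : 'I_m -> 'I_n) (f_inj : injective f)
    (se : sperm m) k : embeds g f ->
  (code (extend_sperm f_inj se) (f k) < 0) = (code se k < 0) /\
  (0 < code (extend_sperm f_inj se) (f k)) = (0 < code se k).
Proof.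
move=> fP; rewrite !codeE /code_ord /= !ffunE !extend_in // !extend_perm_in.
rewrite -![_ == (_ : 'I__)]val_eqE /=.
have := ltn_ord (f (se.1 k)); have := ltn_ord (se.1 k).
have := embeds_lt (se.1 k) k fP; have := embeds_lt k (se.1 k) fP.
move: (nat_of_ord (f (se.1 k))) (nat_of_ord (f k)) (nat_of_ord (se.1 k)) (nat_of_ord k) => a c a' c'.
by case: (se.2 k) => /=; case: (ltngtP a c) => ?; case: (ltngtP a' c') => ?; lia.
Qed.

(** Outside the image of [f] the letters are fixed points, coded 0; elsewhere descents only involve
    signs and comparisons of codes, which [f] preserves. *)
Lemma wmaj_code_extend n m (g : {ffun 'I_n -> bool}) (f : 'I_m -> 'I_n) (f_inj : injective f)
    (se : sperm m) : (\sum_i g i = m)%N -> embeds g f ->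
  wmaj gti (code (extend_sperm f_inj se)) n =
  wmaj gti (merge_word (code se) g) n.
Proof.
move=> em fP; apply: eq_wmaj => t lt_t.
pose j := Ordinal lt_t; pose i := Ordinal (ltnW lt_t).
rewrite -[t.+1]/(nat_of_ord j) -[t]/(nat_of_ord i) !merge_wordE.
have out (x : 'I_n) : ~~ g x -> code (extend_sperm f_inj se) x = 0.
  move=> gx; have fx k : f k != x by apply: contraNneq gx => <-; case: (fP k).
  by rewrite codeE /code_ord /= ffunE extend_out // extend_perm_out // ltnn eqxx.
case: ifPn => [/(embeds_surj em fP)[l ->]|/out ->];
  case: ifPn => [/(embeds_surj em fP)[k ->]|/out ->] //.
- by rewrite (code_extend_lt f_inj _ _ _ fP) !(fP _).2.
- by rewrite (code_extend_sgn f_inj _ _ fP).1 !(fP _).2.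
- by rewrite (code_extend_sgn f_inj _ _ fP).2 !(fP _).2.
Qed.

Definition nofix n (se : sperm n) : bool := [forall i, nonfix se i].

(** The absolute values of the non-fixed letters permute the positions of the mask; relabelling
    along [f] is a bijection onto the signed permutations of size m without fixed points. *)
Lemma big_nonfix (V : nmodType) n m (g : {ffun 'I_n -> bool}) (f : 'I_m -> 'I_n)
    (f_inj : injective f) (F : sperm n -> V) : (\sum_i g i = m)%N -> embeds g f ->
  \sum_(se | nonfix se == g) F se = \sum_(se | nofix se) F (extend_sperm f_inj se).
Proof.
move=> em fP; pose D := [set se : sperm m | nofix se].
transitivity (\sum_(se in D) F (extend_sperm f_inj se)); last first.
  by apply: eq_bigl => se; rewrite inE.
rewrite -[RHS](big_imset F) /=; last exact: (in2W (extend_sperm_inj (f_inj := f_inj))).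
apply: eq_bigl => se; apply/eqP/imsetP => [eg|[se' + ->]]; last first.
  rewrite inE => /forallP nf; apply/ffunP => i; rewrite ffunE /= ffunE.
  case: (codom_case f i) => [[k ->]|fi].
    rewrite extend_in // extend_perm_in (inj_eq f_inj) (fP k).1.
    by have := nf k; rewrite ffunE.
  rewrite extend_out // extend_perm_out // eqxx; apply/esym/negP => gi.
  by have [k ek] := embeds_surj em fP gi; have := fi k; rewrite ek eqxx.
(* If the image were a fixed point, injectivity would make [f k] that same fixed point. *)
have g_im k : g (se.1 (f k)).
  have := (fP k).1; rewrite -eg !ffunE; apply: contraTT => /norP[e0 /negPn/eqP s0].
  by have sx := perm_inj s0; rewrite sx in e0; rewrite (negbTE e0) sx eqxx.
have ex_p (k : 'I_m) : exists l, se.1 (f k) = f l by apply: (embeds_surj em fP).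
have [p pP] := fin_all_exists ex_p.
have p_inj : injective p.
  by move=> k l epkl; apply/f_inj/(@perm_inj _ se.1); rewrite !pP epkl.
exists (perm p_inj, [ffun k => se.2 (f k)]).
  rewrite inE; apply/forallP => k; rewrite !ffunE /= permE -(inj_eq f_inj) -pP.
  by have := (fP k).1; rewrite -eg ffunE.
have g_out i : (forall k, f k != i) -> ~~ se.2 i /\ se.1 i = i.
  move=> fi; have : ~~ g i.
    by apply/negP => /(embeds_surj em fP)[k ek]; have := fi k; rewrite ek eqxx.
  by rewrite -eg ffunE => /norP[-> /negPn/eqP].
rewrite [se in LHS]surjective_pairing; congr pair.
  apply/permP => i; case: (codom_case f i) => [[k ->]|fi].
    by rewrite extend_perm_in permE pP.
  by rewrite extend_perm_out //; case: (g_out i fi).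
apply/ffunP => i; rewrite ffunE; case: (codom_case f i) => [[k ->]|fi].
  by rewrite extend_in // ffunE.
by rewrite extend_out //; apply/negbTE; case: (g_out i fi).
Qed.

(** * Summation over the sets of fixed points *)

Lemma inDDeltaE n (se : sperm n.+1) : inDDelta se.1 se.2 = ~~ se.2 ord_max && nofix se.
Proof.
rewrite /inDDelta; congr (_ && _).
  apply/forallP/idP => [/(_ ord_max)|e_max i].
    by rewrite /= eqxx /sword; case: (se.2 ord_max).
  apply/implyP => /= /eqP ei; have -> : i = ord_max by apply: val_inj.
  by rewrite /sword (negbTE e_max).
apply: eq_forallb => i; rewrite ffunE /sword -(inj_eq val_inj) /=.
by case: (se.2 i) => //=; lia.
Qed.

Lemma code_nofix n (se : sperm n) (i : 'I_n) : nofix se -> code se i != 0.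
Proof.
move=> /forallP /(_ i); rewrite codeE /code_ord ffunE -(inj_eq val_inj) /=.
have := ltn_ord (se.1 i); case: (se.2 i) => /= ?; first by lia.
by case: (ltngtP (se.1 i) i) => //= ? _; lia.
Qed.

(** No value exceeds the last position, so a positive non-fixed last letter is subexcedant. This
    makes [neg_last] true. *)
Lemma code_nofix_max n (se : sperm n.+1) : nofix se -> ~~ se.2 ord_max -> code se n < 0.
Proof.
move=> /forallP /(_ ord_max); rewrite (codeE se ord_max : code se n = _) /code_ord ffunE.
move=> + /negbTE e0; rewrite e0 -(inj_eq val_inj) /=.
by have := ltn_ord (se.1 ord_max); case: (ltngtP (se.1 ord_max) n) => //= ? ? _; lia.
Qed.

(** Group by the mask of non-fixed positions. It always contains the last position, and [m] counts
    the other ones. *)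
Lemma sum_weight_nonmax_nofix (R : fieldType) (eps q : R) n :
  \sum_(se : sperm n.+1 | ~~ se.2 ord_max && (se.1 ord_max != ord_max)) weight eps q se =
  \sum_(m < n.+1) (q ^+ 2) ^+ (n - m) * qbin (q ^+ 2) n m *
     \sum_(se : sperm m.+1 | inDDelta se.1 se.2) weight eps q se.
Proof.
set Q := q ^+ 2.
transitivity (\sum_(g : {ffun 'I_n -> bool})
   \sum_(se : sperm n.+1 | ~~ se.2 ord_max && (nonfix se == ext_ffun g true)) weight eps q se).
  rewrite (partition_big (@nonfix n.+1) predT) //= big_ext_ffun big_bool /= [X in _ + X]big1 ?addr0.
    apply: eq_bigr => g _; apply: eq_bigl => se.
    case: (nonfix se =P ext_ffun g true) => [eqg|]; last by rewrite !andbF.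
    by have := congr1 (fun h : {ffun _ -> bool} => h ord_max) eqg;
      rewrite ext_ffun_max ffunE; case: (se.2 ord_max) => //= ->.
  move=> g _; rewrite big_pred0 // => se.
  case: (nonfix se =P ext_ffun g false) => [eqg|]; last by rewrite andbF.
  by have := congr1 (fun h : {ffun _ -> bool} => h ord_max) eqg;
      rewrite ext_ffun_max ffunE; case: (se.2 ord_max) => //= ->.
pose W m (se : sperm m.+1) (g : {ffun 'I_n -> bool}) :=
  eps ^+ odd_perm se.1 * (eps * q) ^+ (\sum_i se.2 i) *
  Q ^+ wmaj gti (merge_word (code se) (ext_ffun g true)) n.+1.
transitivity (\sum_(g : {ffun 'I_n -> bool})
   \sum_(se : sperm (\sum_i g i).+1 | inDDelta se.1 se.2) W _ se g).
  apply: eq_bigr => g _; set m := (\sum_i g i)%N.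
  have em : (\sum_i ext_ffun g true i = m.+1)%N by rewrite sum_ext_ffun addn1.
  have [f fP] := embeds_exists em; have f_inj := embeds_inj fP.
  (* The last position survives the deletion, so the reduced word still ends with a positive
     letter. *)
  have f_max : f ord_max = ord_max.
    have [|k ek] := @embeds_surj _ _ _ f ord_max em fP; first exact: ext_ffun_max.
    rewrite ek; congr f; apply: val_inj; rewrite [RHS]/= -(fP k).2 -ek.
    by rewrite rank_ext // rank_full.
  rewrite (eq_bigl (fun se => (nonfix se == ext_ffun g true) && ~~ se.2 ord_max));
    last by move=> se; rewrite andbC.
  rewrite big_mkcondr (big_nonfix f_inj _ em fP) -big_mkcondr.
  apply: eq_big => se; first by rewrite inDDeltaE andbC /= ffunE -f_max extend_in.
  move=> _; rewrite /weight sum_extend_sign /= odd_extend_perm.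
  by rewrite (smaj_code (extend_sperm f_inj se)) (wmaj_code_extend f_inj _ em fP).
rewrite (partition_big (fun g : {ffun 'I_n -> bool} => inord (\sum_i g i) : 'I_n.+1) predT) //=.
apply: eq_bigr => m _.
have le_sum (g : {ffun 'I_n -> bool}) : (\sum_i g i < n.+1)%N.
  rewrite ltnS -[leqRHS]card_ord -sum1_card; apply: leq_sum => i _; exact: leq_b1.
transitivity (\sum_(g : {ffun 'I_n -> bool} | (\sum_i g i + true == m.+1)%N)
   \sum_(se : sperm m.+1 | inDDelta se.1 se.2) W _ se g).
  apply: eq_big => [g|g /eqP <-]; last by rewrite inordK.
  by rewrite addn1 eqSS -val_eqE /= inordK.
rewrite exchange_big mulr_sumr /=; apply: eq_bigr => se; rewrite inDDeltaE => /andP[e0 nf].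
rewrite /W -mulr_sumr -/(merge_sum Q (code se) n m.+1 true).
(* The shuffle ends with a subexcedant of the reduced word, whence the factor Q^(n-m). *)
have [|_ ->] := @merge_sumE _ Q (code se) n m.+1.
  by move=> i lt_i; exact: (@code_nofix _ _ (Ordinal lt_i)).
by rewrite /neg_last code_nofix_max // /weight -smaj_code -/Q [RHS]mulrC -!mulrA.
Qed.

(** * Inversion *)

Lemma double_bin2 k : (2 * 'C(k.+1, 2) = k * k.+1)%N.
Proof. by elim: k => [|k IHk] //; rewrite binS mulnDr IHk bin1; lia. Qed.

Lemma qbinn (R : comNzRingType) (Q : R) n : qbin Q n n = 1.
Proof. by elim: n => // n IHn; rewrite qbinS IHn qbin_small ?mulr0 ?addr0. Qed.

(** By the q-binomial theorem this is the product of the 1 - Q^i for i < L, whose factor at i = 0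
    vanishes. *)
Lemma sum_qbin_alt (R : comNzRingType) (Q : R) L K : (L <= K)%N ->
  \sum_(0 <= k < K.+1) (-1) ^+ k * Q ^+ 'C(k, 2) * qbin Q L k = (L == 0%N)%:R.
Proof.
case: L => [_|L lt_LK].
  rewrite big_nat_recl // big1 ?addr0 => [|k _]; last by rewrite mulr0.
  by rewrite qbin0 !mulr1.
(* The partial sums have a closed form, whose binomial is zero because L < K. *)
suff -> : \sum_(0 <= k < K.+1) (-1) ^+ k * Q ^+ 'C(k, 2) * qbin Q L.+1 k =
    (-1) ^+ K * Q ^+ 'C(K.+1, 2) * qbin Q L K by rewrite qbin_small ?mulr0.
elim: K {lt_LK} => [|K IHK]; first by rewrite big_nat1 !qbin0.
rewrite big_nat_recr //= IHK qbinS (binS K.+1) bin1 exprD !exprS; ring.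
Qed.

(** Equals (1+q)^n times the Q-factorial for Q = q^2; the powers of 1+q cancel in binomials. *)
Definition qfact (R : nzRingType) (q : R) n : R := \prod_(1 <= i < n.+1) qint (2 * i) q.

Lemma qfactS (R : nzRingType) (q : R) n : qfact q n.+1 = qfact q n * qint (2 * n.+1) q.
Proof. by rewrite /qfact big_nat_recr. Qed.

Lemma qfact0 (R : nzRingType) (q : R) : qfact q 0 = 1.
Proof. by rewrite /qfact big_nil. Qed.

Lemma qbin_fact (R : comNzRingType) (q : R) k d :
  qbin (q ^+ 2) (k + d) k * (qfact q k * qfact q d) = qfact q (k + d).
Proof.
move En: (k + d)%N => n; elim: n => [|n IHn] in k d En *.
  by case: k d En => [|//] [|//] _; rewrite !qfact0 !mulr1.
case: k En => [En|k]; first by rewrite qbin0 qfact0 !mul1r -En.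
rewrite addSn => -[En]; rewrite qbinS -exprM.
have e1 := IHn k d En.
have e2 : qbin (q ^+ 2) n k.+1 * (qfact q k.+1 * qfact q d) = qfact q n * qint (2 * d) q.
  case: d En e1 => [|d] En _; last by rewrite (qfactS q d) -(IHn k.+1 d) ?addSnnS // !mulrA.
  by rewrite qbin_small ?mul0r -?En ?addn0 // /qint big_ord0 mulr0.
have -> : qfact q n.+1 = qfact q n * (qint (2 * k.+1) q + q ^+ (2 * k.+1) * qint (2 * d) q).
  by rewrite qfactS -qint_split; congr (_ * qint _ _); lia.
rewrite mulrDl -mulrA e2 (qfactS q k) -e1; ring.
Qed.

(** Both sides are the same Q-multinomial coefficient, seen after clearing nonzero factorials. *)
Lemma qbin_trinomial (F : fieldType) (q : F) N k m : (k + m <= N)%N ->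
  (forall j, (j <= N)%N -> qfact q j != 0) ->
  qbin (q ^+ 2) N k * qbin (q ^+ 2) (N - k) m = qbin (q ^+ 2) N m * qbin (q ^+ 2) (N - m) k.
Proof.
move=> le_kmN nz; have [d eN] : exists d, (k + (m + d) = N)%N.
  by exists (N - (k + m))%N; rewrite addnA subnKC.
have eN' : (m + (k + d) = N)%N by rewrite addnCA.
have e1 := qbin_fact q k (m + d); have e2 := qbin_fact q m d.
have e3 := qbin_fact q m (k + d); have e4 := qbin_fact q k d.
rewrite eN in e1; rewrite eN' in e3.
have -> : (N - k = m + d)%N by rewrite -eN addKn.
have -> : (N - m = k + d)%N by rewrite -eN' addKn.
have nz3 : qfact q k * qfact q m * qfact q d != 0.
  by rewrite !mulf_neq0 ?nz //; lia.
apply: (mulIf nz3).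
have mulA5 (x y u v w : F) : x * y * (u * v * w) = x * (u * (y * (v * w))) by ring.
have mulA5' (x y u v w : F) : x * y * (u * v * w) = x * (v * (y * (u * w))) by ring.
by rewrite mulA5 e2 e1 mulA5' e4 e3.
Qed.

(** Substitute [c] and exchange the sums: trinomial revision turns the inner one into [sum_qbin_alt]
    with L = N - m. *)
Lemma qbin_inversion (F : fieldType) (q : F) (a c : nat -> F) N :
  (forall j, (j <= N)%N -> qfact q j != 0) ->
  (forall n, c n = \sum_(m < n.+1) (q ^+ 2) ^+ (n - m) * qbin (q ^+ 2) n m * a m) ->
  a N = \sum_(0 <= k < N.+1) (-1) ^+ k * (q ^+ 2) ^+ 'C(k.+1, 2) * qbin (q ^+ 2) N k * c (N - k)%N.
Proof.
move=> nz ec; set Q := q ^+ 2.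
(* Padding with zero binomials gives all inner sums a common range, ready for the exchange. *)
have ec' k : (k < N.+1)%N -> c (N - k)%N =
    \sum_(0 <= m < N.+1) Q ^+ (N - k - m) * qbin Q (N - k) m * a m.
  move=> lt_k; rewrite ec -(big_mkord predT (fun m => Q ^+ (N - k - m) * qbin Q (N - k) m * a m)).
  rewrite [RHS](big_cat_nat (n := (N - k).+1)) //=; last by rewrite ltnS leq_subr.
  rewrite [X in _ + X]big_nat [X in _ + X]big1 ?addr0 // => m /andP[lt_m _].
  by rewrite qbin_small // mulr0 mul0r.
transitivity (\sum_(0 <= m < N.+1) a m * (qbin Q N m * Q ^+ (N - m) *
   \sum_(0 <= k < N.+1) (-1) ^+ k * Q ^+ 'C(k, 2) * qbin Q (N - m) k)).
  rewrite big_nat_recr //= sum_qbin_alt ?leq_subr // subnn qbinn !mulr1 big_nat big1 ?add0r //.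
  move=> m /andP[_ lt_m]; rewrite sum_qbin_alt ?leq_subr //.
  by rewrite subn_eq0 leqNgt lt_m !mulr0.
under [RHS]eq_big_nat => k /andP[_ lt_k] do rewrite ec' // mulr_sumr.
rewrite exchange_big_nat /=; apply: eq_big_nat => m /andP[_ lt_m].
rewrite !mulr_sumr; apply: eq_big_nat => k /andP[_ lt_k].
have [le_kmN|lt_N] := leqP (k + m) N; last first.
  by rewrite !(@qbin_small _ Q (N - _)) ?(mulr0, mul0r) //; lia.
have e1 := qbin_trinomial le_kmN nz.
have e2 : Q ^+ 'C(k.+1, 2) * Q ^+ (N - k - m) = Q ^+ 'C(k, 2) * Q ^+ (N - m).
  by rewrite -!exprD; congr (_ ^+ _); rewrite binS bin1; lia.
have mulA6 (x s y b b' z : F) : s * y * b * (z * b' * x) = x * (s * ((y * z) * (b * b'))) by ring.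
have mulA6' (x s y b b' z : F) : x * (b * z * (s * y * b')) = x * (s * ((y * z) * (b * b'))) by ring.
by rewrite mulA6 mulA6' e1 e2.
Qed.

(** As q is an element of a field, the denominators of the formula are assumed nonzero. *)
Theorem theorem5p1 (R : fieldType) (n : nat) (eps q : R) :
  (eps = 1 \/ eps = -1) -> (2 <= n)%N ->
  1 - eps * q != 0 ->
  (forall j : nat, (1 <= j < n)%N -> qint (2 * j) q != 0) ->
  \sum_(se : {perm 'I_n} * {ffun 'I_n -> bool} | inDDelta se.1 se.2)
      eps ^ (ellB se.1 se.2) * q ^+ (fmaj se.1 se.2)
  = (\prod_(1 <= j < n) qint (2 * j) q) *
    \sum_(0 <= k < n.-1)
      ((-1) ^+ k * q ^+ (k * k + k + 1) * qint (n - k - 1) q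
         / \prod_(1 <= j < k.+1) qint (2 * j) q
       * eps ^+ (n - k)
       * ((1 - q) / (1 - eps * q)) ^+ (uphalf (n - k))).
Proof.
move=> eps1 n_gt1 nz nz_qint.
have eps2 : eps ^+ 2 = 1 by case: eps1 => ->; rewrite ?sqrrN expr1n.
case: n n_gt1 nz_qint => // N N_gt0 nz_qint; rewrite /= -/(qfact q N).
have nz_fact j : (j <= N)%N -> qfact q j != 0.
  move=> le_j; rewrite /qfact prodf_seq_neq0; apply/allP => i /=.
  rewrite mem_index_iota => /andP[i_gt0 lt_i]; apply: nz_qint.
  by rewrite i_gt0 ltnS (leq_trans _ le_j).
rewrite (eq_bigr _ (fun se _ => weightE q se eps2)).
pose a m := \sum_(se : sperm m.+1 | inDDelta se.1 se.2) weight eps q se.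
rewrite -[LHS]/(a N).
rewrite (qbin_inversion nz_fact (fun n => sum_weight_nonmax_nofix eps q n)).
(* The term k = N contains [0]_q = 0, so the sum stops at n-2. *)
rewrite big_nat_recr //= sum_weight_nonmaxE // subnn.
have qint0 : qint 0 q = 0 by rewrite /qint big_ord0.
rewrite qint0 !(mulr0, mul0r) addr0 mulr_sumr.
apply: eq_big_nat => k /andP[_ lt_k].
rewrite sum_weight_nonmaxE // -/(qfact q k) -/(qfact q (N - k)).
rewrite subSn ?(ltnW lt_k) // subSS subn0.
(* The binomial times [qfact q (N - k)] is [qfact q N] over [qfact q k]: the outer product and the
   denominator. *)
have := qbin_fact q k (N - k); rewrite subnKC ?(ltnW lt_k) // => <-.
(* Inversion contributes q^(k(k+1)); the remaining q comes from the sum over last letters. *)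
rewrite -exprM double_bin2 (_ : k * k + k + 1 = (k * k.+1).+1)%N; last by lia.
rewrite (exprSr q (k * k.+1)).
have := nz_fact k (ltnW lt_k).
set r := _ ^+ (uphalf _).
move: (qbin _ _ _) (qfact q k) (qfact q (N - k)) (qint _ _) r (eps ^+ _) (q ^+ _) ((-1) ^+ k)
  => A B C D r' E G H nzB.
by field.
Qed.
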